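(* Let $A\in\mathbb{R}^{m\times n}$ and $B\in\mathbb{R}^{m\times r}$. Consider the following greedy procedure. Set $\mathcal{S}_1=\emptyset$. For $k=1,2,\dots$, given $\mathcal{S}_k$, define $E_k=A-P^{(\mathcal{S}_k)}A$, $F_k=B-P^{(\mathcal{S}_k)}B$, $G_k=E_k^{T}E_k\in\mathbb{R}^{n\times n}$, $H_k=F_k^{T}E_k\in\mathbb{R}^{r\times n}$, and vectors $\mathbf{f}^{(k)},\mathbf{g}^{(k)}\in\mathbb{R}^n$ by $\mathbf{f}^{(k)}_i=\|(H_k)_{:i}\|^2$, $\mathbf{g}^{(k)}_i=(G_k)_{ii}$. At iteration $k$ a column $p_k$ is selected as $p_k=\arg\max_i \mathbf{f}^{(k)}_i/\mathbf{g}^{(k)}_i$ (assume $(G_k)_{p_kp_k}>0$), and one sets $\mathcal{S}_{k+1}=\mathcal{S}_k\cup\{p_k\}$, $$\boldsymbol{\omega}^{(k)}=\frac{(G_k)_{:p_k}}{\sqrt{(G_k)_{p_kp_k}}}\in\mathbb{R}^n,\qquad \boldsymbol{\upsilon}^{(k)}=\frac{(H_k)_{:p_k}}{\sqrt{(G_k)_{p_kp_k}}}\in\mathbb{R}^r.$$ Then for every $t\ge 2$ (for which these quantities are defined), $$\mathbf{f}^{(t)}=\mathbf{f}^{(t-1)}-2\left(\boldsymbol{\omega}^{(t-1)}\circ\left(A^{T}B\boldsymbol{\upsilon}^{(t-1)}-\sum_{r=1}^{t-2}\left(\boldsymbol{\upsilon}^{(r)T}\boldsymbol{\upsilon}^{(t-1)}\right)\boldsymbol{\omega}^{(r)}\right)\right)+\|\boldsymbol{\upsilon}^{(t-1)}\|^{2}\left(\boldsymbol{\omega}^{(t-1)}\circ\boldsymbol{\omega}^{(t-1)}\right),$$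 $$\mathbf{g}^{(t)}=\mathbf{g}^{(t-1)}-\boldsymbol{\omega}^{(t-1)}\circ\boldsymbol{\omega}^{(t-1)}.$$
   Context: For a matrix $M$ and an index set $\mathcal{T}$ (or single index $i$), $M_{:\mathcal{T}}$ (resp. $M_{:i}$) denotes the submatrix (resp. column) of $M$ with the indicated columns. For a set $\mathcal{T}$ of column indices of $A$ with $A_{:\mathcal{T}}$ of full column rank, $P^{(\mathcal{T})}=A_{:\mathcal{T}}\left(A_{:\mathcal{T}}^{T}A_{:\mathcal{T}}\right)^{-1}A_{:\mathcal{T}}^{T}$ is the orthogonal projection onto the span of those columns, with $P^{(\emptyset)}=0$. $\circ$ denotes the Hadamard (entrywise) product and $\|\cdot\|$ the Euclidean norm. Empty sums are zero. *)

(* Defs.v *)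
From mathcomp Require Import all_boot all_order all_algebra.
From mathcomp Require Import reals.

Set Implicit Arguments.
Unset Strict Implicit.
Unset Printing Implicit Defensive.

Import Order.TTheory GRing.Theory Num.Theory.
Local Open Scope ring_scope.

(* The norm provided by MathComp-Analysis on matrices is the sup norm, hence
   this separate definition. *)
Definition enorm (R : realType) (d : nat) (v : 'cV[R]_d) : R :=
  Num.sqrt (\sum_i v i 0 ^+ 2).

Definition hadamard (R : realType) (d : nat) (u v : 'cV[R]_d) : 'cV[R]_d :=
  \col_i (u i 0 * v i 0).

Section Residuals.
Variables (R : realType) (m n r : nat).
Variables (A : 'M[R]_(m, n)) (B : 'M[R]_(m, r)) (T : {set 'I_n}).

Definition cols : 'M[R]_(m, #|T|) :=
  colsub (fun j : 'I_#|T| => enum_val j) A.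

(* Meaningful when [cols] has full column rank; otherwise [invmx] returns its
   argument. *)
Definition proj : 'M[R]_m := cols *m invmx (cols^T *m cols) *m cols^T.

Definition resE : 'M[R]_(m, n) := A - proj *m A.
Definition resF : 'M[R]_(m, r) := B - proj *m B.
Definition gramG : 'M[R]_n := resE^T *m resE.
Definition gramH : 'M[R]_(r, n) := resF^T *m resE.

Definition fvec : 'cV[R]_n := \col_i (enorm (col i gramH) ^+ 2).
Definition gvec : 'cV[R]_n := \col_i gramG i i.

Definition omega (p : 'I_n) : 'cV[R]_n :=
  (Num.sqrt (gramG p p))^-1 *: col p gramG.
Definition upsilon (p : 'I_n) : 'cV[R]_r :=
  (Num.sqrt (gramG p p))^-1 *: col p gramH.

(* The maximum is over the indices whose quotient is defined; [gvec i 0 = 0]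
   happens in particular for i in T. Ties may be broken arbitrarily. *)
Definition is_argmax (p : 'I_n) : Prop :=
  forall i : 'I_n, gvec i 0 != 0 ->
    fvec i 0 / gvec i 0 <= fvec p 0 / gvec p 0.

End Residuals.

Lemma proj_set0 (R : realType) (m n : nat) (A : 'M[R]_(m, n)) :
  proj A set0 = 0.
Proof.
apply/matrixP=> i j; rewrite !mxE big1 // => k _.
by have := ltn_ord k; rewrite [X in (_ < X)%N]cards0 ltn0.
Qed.

(* Iterations 1, ..., t - 1 of the greedy procedure have been carried out, so
   that S 1, ..., S t are determined. Values of S and p outside the ranges
   1..t and 1..t-1 are irrelevant. *)
Definition greedy_run (R : realType) (m n r : nat)
    (A : 'M[R]_(m, n)) (B : 'M[R]_(m, r))
    (S : nat -> {set 'I_n}) (p : nat -> 'I_n) (t : nat) : Prop :=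
  S 1%N = set0 /\
  forall k : nat, (1 <= k < t)%N ->
    [/\ 0 < gramG A (S k) (p k) (p k),
        is_argmax A B (S k) (p k)
      & S k.+1 = S k :|: [set p k]].

(* Main.v *)
Require Import Defs.
From mathcomp Require Import all_boot all_order all_algebra.
From mathcomp Require Import reals ring.

Set Implicit Arguments.
Unset Strict Implicit.
Unset Printing Implicit Defensive.

Import Order.TTheory GRing.Theory Num.Theory.
Local Open Scope ring_scope.

(** If the residual [e = A_p - P A_p] of the selected column is nonzero, then
    the columns indexed by [T] together with [p] are still independent and the
    new projection is [P + q q^T] with [q = e / |e|]. Since [E^T q = omega] and
    [F^T q = upsilon], this gives [G' = G - omega omega^T] and
    [H' = H - upsilon omega^T]. The diagonal of the first identity is the
    update of [g]; expanding the column norms in the second, and unrolling it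
    to [H_k = B^T A - \sum_s upsilon_s omega_s^T], gives the update of [f]. *)

(** * Euclidean norms and matrix columns *)

Lemma enorm_sqr (R : realType) (d : nat) (v : 'cV[R]_d) :
  enorm v ^+ 2 = \sum_i v i 0 ^+ 2.
Proof. by rewrite sqr_sqrtr // sumr_ge0 // => i _; exact: sqr_ge0. Qed.

Lemma trmx_mul_eq0 (R : realType) (d : nat) (v : 'cV[R]_d) :
  v^T *m v = 0 -> v = 0.
Proof.
move=> /matrixP /(_ 0 0); rewrite !mxE => vv0.
have /psumr_eq0P sq0 : \sum_i v i 0 ^+ 2 = 0.
  by rewrite -[RHS]vv0; apply: eq_bigr => i _; rewrite !mxE expr2.
apply/matrixP=> i j; rewrite ord1 [RHS]mxE; apply/eqP; rewrite -sqrf_eq0.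
by apply/eqP/sq0 => // k _; exact: sqr_ge0.
Qed.

Lemma col_mul (R : pzSemiRingType) (m n q : nat) (j : 'I_q)
    (M : 'M[R]_(m, n)) (N : 'M[R]_(n, q)) :
  col j (M *m N) = M *m col j N.
Proof. by rewrite !colE mulmxA. Qed.

(** * Projections onto selected columns, and adding one column *)

Section Projection.
Variables (R : realType) (m n : nat) (A : 'M[R]_(m, n)).
Implicit Type T : {set 'I_n}.

(* Linear independence of the columns indexed by [T], phrased in [R^n] so that
   it does not mention the type ['I_#|T|]. *)
Definition indep T : Prop :=
  forall x : 'cV[R]_n, (forall i, i \notin T -> x i 0 = 0) ->
    A *m x = 0 -> x = 0.

(** Left multiplication by [selmx T] extends by zero outside [T], which turns coefficients over
    ['I_#|T|] into the vectors that [indep] speaks of. *)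
Definition selmx T : 'M[R]_(n, #|T|) :=
  colsub (fun j : 'I_#|T| => enum_val j) 1%:M.

Lemma colsE T : cols A T = A *m selmx T.
Proof. by rewrite /cols /selmx mulmx_colsub mulmx1. Qed.

Lemma indep0 : indep set0.
Proof.
by move=> x x0 _; apply/matrixP=> i j; rewrite ord1 x0 ?inE // mxE.
Qed.

Lemma selmx_notin T q (Y : 'M[R]_(#|T|, q)) i j :
  i \notin T -> (selmx T *m Y) i j = 0.
Proof.
move=> iT; rewrite mxE big1 // => k _; rewrite !mxE.
by case: eqP iT => [->|_ _]; rewrite ?enum_valP ?mul0r.
Qed.

Lemma selmx_enum_val T q (Y : 'M[R]_(#|T|, q)) k j :
  (selmx T *m Y) (enum_val k) j = Y k j.
Proof.
rewrite mxE (bigD1 k) //= !mxE eqxx mul1r big1 ?addr0 // => l lk.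
by rewrite !mxE (inj_eq enum_val_inj) eq_sym (negPf lk) mul0r.
Qed.

(** If a row [v] kills the Gram matrix of [C = cols A T], then [|C v^T|^2 = 0], and independence
    forces [v = 0]. *)
Lemma gram_unit T : indep T -> (cols A T)^T *m cols A T \in unitmx.
Proof.
move=> iT; rewrite -row_free_unit; apply: inj_row_free => v vG.
have : cols A T *m v^T = 0.
  apply: trmx_mul_eq0; rewrite trmx_mul trmxK mulmxA.
  by rewrite -[v *m _ *m _]mulmxA vG mul0mx.
rewrite colsE -mulmxA => /iT sel0.
have {}sel0 : selmx T *m v^T = 0 by apply: sel0 => i; exact: selmx_notin.
apply/matrixP=> i k; rewrite ord1.
have -> : v 0 k = v^T k 0 by rewrite mxE.
by rewrite -selmx_enum_val sel0 !mxE.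
Qed.

Lemma proj_sym T : (proj A T)^T = proj A T.
Proof. by rewrite /proj !trmx_mul trmx_inv trmx_mul !trmxK mulmxA. Qed.

Lemma proj_cols T : indep T -> proj A T *m cols A T = cols A T.
Proof. by move=> /gram_unit uG; rewrite /proj -!mulmxA mulVmx // mulmx1. Qed.

Lemma proj_in T j : indep T -> j \in T -> proj A T *m col j A = col j A.
Proof.
move=> iT jT; have /(congr1 (col (enum_rank_in jT j))) := proj_cols iT.
rewrite col_mul; suff -> : col (enum_rank_in jT j) (cols A T) = col j A by [].
by apply/matrixP=> a b; rewrite !mxE enum_rankK_in.
Qed.

Lemma proj_span T : exists2 Y : 'M[R]_(n, m),
  forall i j, i \notin T -> Y i j = 0 & proj A T = A *m Y.
Proof.
exists (selmx T *m (invmx ((cols A T)^T *m cols A T) *m (cols A T)^T)).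
  by move=> i j; exact: selmx_notin.
by rewrite mulmxA -colsE mulmxA.
Qed.

Lemma proj_idem T : indep T -> proj A T *m proj A T = proj A T.
Proof. by move=> iT; rewrite {2}/proj !mulmxA proj_cols. Qed.

(** With [P = proj A T], fixing the columns gives [Q P = P] and having range in their span gives
    [P Q = Q]; by symmetry [P = Q P = (P Q)^T = Q]. This identifies the enlarged projection without
    inverting its Gram matrix. *)
Lemma proj_unique T (Q : 'M[R]_m) (Y : 'M[R]_(n, m)) : indep T ->
  Q^T = Q -> (forall j, j \in T -> Q *m col j A = col j A) ->
  (forall i j, i \notin T -> Y i j = 0) -> Q = A *m Y ->
  proj A T = Q.
Proof.
move=> iT Qs QA Y0 QY.
have QC : Q *m cols A T = cols A T.
  apply/matrixP=> i j; have /matrixP/(_ i 0) := QA _ (enum_valP j).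
  by rewrite -col_mul !mxE => <-; apply: eq_bigr => k _; rewrite !mxE.
have QP : Q *m proj A T = proj A T by rewrite /proj !mulmxA QC.
have PQ : proj A T *m Q = Q.
  apply/eqP; rewrite -subr_eq0 QY mulmxA -mulmxBl; apply/eqP/matrixP=> i j.
  rewrite !mxE big1 // => k _; have [kT|kT] := boolP (k \in T); last first.
    by rewrite Y0 // mulr0.
  have /matrixP/(_ i 0) := proj_in iT kT.
  by rewrite -col_mul !mxE => ->; rewrite subrr mul0r.
by rewrite -QP -[LHS]trmxK trmx_mul proj_sym Qs PQ Qs.
Qed.

Lemma col_resE T p : col p (resE A T) = col p A - proj A T *m col p A.
Proof. by rewrite /resE -col_mul; apply/matrixP=> i j; rewrite !mxE. Qed.

Lemma gramG_col T i j :
  gramG A T i j = ((col i (resE A T))^T *m col j (resE A T)) 0 0.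
Proof. by rewrite !mxE; apply: eq_bigr => k _; rewrite !mxE. Qed.

(** Columns of the residual [E] in [T] vanish, so [E x] is [x_p] times column [p] of [E]. But
    [A x = 0] gives [E x = 0], hence [x_p = 0] and [x] is supported in [T]. *)
Lemma indepU1 T p : indep T -> 0 < gramG A T p p -> indep (T :|: [set p]).
Proof.
move=> iT gp x xT Ax; apply: (iT x) => // i iT'.
have [->|ip] := eqVneq i p; last by rewrite xT // !inE negb_or iT' ip.
have Ex : resE A T *m x = x p 0 *: col p (resE A T).
  apply/matrixP=> a b; rewrite !mxE (bigD1 p) //= ord1 big1 ?addr0; last first.
    move=> k kp; have [kT|kT] := boolP (k \in T).
      have /matrixP/(_ a 0) : col k (resE A T) = 0.
        by rewrite col_resE proj_in // subrr.
      by rewrite [LHS]mxE => ->; rewrite mxE mul0r.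
    by rewrite xT ?mulr0 // !inE negb_or kT kp.
  by rewrite mulrC !mxE.
have {}Ex : x p 0 *: col p (resE A T) = 0.
  by rewrite -Ex /resE mulmxBl -mulmxA Ax mulmx0 subr0.
apply/eqP; move/eqP: Ex; rewrite scaler_eq0 => /orP[//|/eqP e0].
by move: gp; rewrite gramG_col e0 mulmx0 mxE ltxx.
Qed.

Definition resdir T p : 'cV[R]_m :=
  (Num.sqrt (gramG A T p p))^-1 *: col p (resE A T).

Lemma proj_resdir T p : indep T -> proj A T *m resdir T p = 0.
Proof.
move=> iT; rewrite -scalemxAr col_resE mulmxBr mulmxA proj_idem //.
by rewrite subrr scaler0.
Qed.

Lemma resdir_unit T p : 0 < gramG A T p p ->
  (resdir T p)^T *m resdir T p = 1%:M.
Proof.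
move=> gp; rewrite /resdir -scalemxAr linearZ /= -scalemxAl scalerA.
rewrite [_ *m _]mx11_scalar -gramG_col -invfM -expr2 sqr_sqrtr ?ltW //.
by rewrite scale_scalar_mx mulVf // gt_eqF.
Qed.

Lemma projU1 T p : indep T -> 0 < gramG A T p p ->
  proj A (T :|: [set p]) = proj A T + resdir T p *m (resdir T p)^T.
Proof.
move=> iT gp; set q := resdir T p; set s := Num.sqrt (gramG A T p p).
have s0 : s != 0 by rewrite gt_eqF // sqrtr_gt0.
have Pq : proj A T *m q = 0 by exact: proj_resdir.
have qP : q^T *m proj A T = 0 by rewrite -[proj A T]proj_sym -trmx_mul Pq trmx0.
have qq : q^T *m q = 1%:M by exact: resdir_unit.
have eq : col p (resE A T) = s *: q.
  by rewrite /q /resdir scalerA divff // scale1r.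
have [Y Y0 PY] := proj_span T.
(* Since [P = A Y], [q = s^-1 (A_p - P A_p)] is [A] applied to [s^-1 (e_p - Y A_p)]; so
   [P + q q^T = A Z]. *)
pose Z := Y + (s^-1 *: (col p 1%:M - col p (Y *m A))) *m q^T.
apply: (@proj_unique _ _ Z).
- exact: indepU1.
- by rewrite linearD /= proj_sym trmx_mul trmxK.
- move=> j; rewrite !inE mulmxDl => /orP[jT|/eqP->].
    rewrite proj_in // -(proj_in iT jT) -mulmxA.
    by rewrite (mulmxA q^T) qP mul0mx mulmx0 addr0.
  (* Of the two orthogonal parts of the new column, [P] fixes the first and [q q^T] the second. *)
  have -> : col p A = proj A T *m col p A + s *: q.
    by rewrite -eq col_resE addrCA subrr addr0.
  rewrite !mulmxDr -!(scalemxAr s) (mulmxA (proj A T) (proj A T)) proj_idem //.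
  rewrite Pq scaler0 addr0 -(mulmxA q q^T q) qq mulmx1 -(mulmxA q q^T).
  by rewrite (mulmxA q^T) qP mul0mx mulmx0 add0r.
- move=> i j; rewrite !inE negb_or => /andP[iT' ip].
  rewrite mxE Y0 // add0r mxE big1 // => k _; rewrite !mxE (negPf ip).
  rewrite big1; first by rewrite subr0 mulr0 mul0r.
  by move=> l _; rewrite Y0 // mul0r.
- rewrite mulmxDr PY; congr (_ + _); rewrite mulmxA; congr (_ *m _).
  rewrite /q /resdir -/s -scalemxAr col_resE mulmxBr -!col_mul mulmx1.
  by rewrite mulmxA -PY.
Qed.

End Projection.

(** * Rank-one updates of the residuals and of [G], [H], [f], [g] *)

Section Update.
Variables (R : realType) (m n r : nat) (A : 'M[R]_(m, n)) (B : 'M[R]_(m, r)).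
Variables (T : {set 'I_n}) (p : 'I_n).
Hypothesis iT : indep A T.

Lemma resF_resdir : (resF A B T)^T *m resdir A T p = B^T *m resdir A T p.
Proof.
rewrite /resF linearB /= trmx_mul proj_sym mulmxBl -mulmxA proj_resdir //.
by rewrite mulmx0 subr0.
Qed.

Lemma upsilonE : upsilon A B T p = (resF A B T)^T *m resdir A T p.
Proof. by rewrite /upsilon /resdir -scalemxAr -col_mul. Qed.

Hypothesis gp : 0 < gramG A T p p.

Lemma resF_update :
  resF A B (T :|: [set p]) = resF A B T - resdir A T p *m (upsilon A B T p)^T.
Proof.
rewrite upsilonE resF_resdir trmx_mul trmxK {1}/resF projU1 // mulmxDl.
by rewrite opprD addrA mulmxA.
Qed.

End Update.

(** For [B := A], [F] and [H] become [E] and [G], so the updates of [E] and [G] are instances of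
    those of [F] and [H]. *)
Lemma omegaE (R : realType) (m n : nat) (A : 'M[R]_(m, n)) T p :
  omega A T p = upsilon A A T p.
Proof. by []. Qed.

(** In [(F - q v^T)^T (E - q w^T)] both cross terms equal [- v w^T], and [q^T q = 1] makes the last
    term [+ v w^T]. *)
Lemma gramH_update (R : realType) (m n r : nat) (A : 'M[R]_(m, n))
    (B : 'M[R]_(m, r)) T p : indep A T -> 0 < gramG A T p p ->
  gramH A B (T :|: [set p]) =
    gramH A B T - upsilon A B T p *m (omega A T p)^T.
Proof.
move=> iT gp; rewrite /gramH.
have -> : resE A (T :|: [set p]) = resE A T - resdir A T p *m (omega A T p)^T.
  exact: resF_update.
rewrite resF_update //.
have := resdir_unit gp; have := upsilonE A B T p.
have : omega A T p = (resE A T)^T *m resdir A T p by exact: upsilonE.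
move: (resE A T) (resF A B T) (resdir A T p) (omega A T p) (upsilon A B T p).
move=> E F q w v wE vE qq; rewrite [(_ - _)^T]linearB /= trmx_mul trmxK.
rewrite mulmxBl !mulmxBr !mulmxA -vE -(mulmxA v q^T q) qq mulmx1 -(mulmxA v).
by rewrite -[q^T *m E]trmxK trmx_mul trmxK -wE subrr subr0.
Qed.

Lemma gvec_update (R : realType) (m n : nat) (A : 'M[R]_(m, n)) T p :
  indep A T -> 0 < gramG A T p p ->
  gvec A (T :|: [set p]) =
    gvec A T - hadamard (omega A T p) (omega A T p).
Proof.
move=> iT gp; apply/matrixP=> i j; rewrite [LHS]mxE.
rewrite -[gramG _ _]/(gramH A A _) gramH_update // -omegaE.
by rewrite !mxE big_ord1 !mxE.
Qed.

(** Column [i] of the new [H] is [H_i - w_i v], with squared norm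
    [|H_i|^2 - 2 w_i (H^T v)_i + |v|^2 w_i^2]. *)
Lemma fvec_update (R : realType) (m n r : nat) (A : 'M[R]_(m, n))
    (B : 'M[R]_(m, r)) T p : indep A T -> 0 < gramG A T p p ->
  fvec A B (T :|: [set p]) =
    fvec A B T
    - 2 *: hadamard (omega A T p) ((gramH A B T)^T *m upsilon A B T p)
    + enorm (upsilon A B T p) ^+ 2 *: hadamard (omega A T p) (omega A T p).
Proof.
move=> iT gp; apply/matrixP=> i j; rewrite [LHS]mxE gramH_update //.
set w := omega A T p; set v := upsilon A B T p; set H := gramH A B T.
rewrite !mxE !enorm_sqr -/H mulrA mulr_sumr mulr_suml -sumrB -big_split /=.
by apply: eq_bigr => k _; rewrite !mxE big_ord1 !mxE; ring.
Qed.

(** * The greedy run, by induction on the iteration *)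

Section Run.
Variables (R : realType) (m n r : nat) (A : 'M[R]_(m, n)) (B : 'M[R]_(m, r)).
Variables (S : nat -> {set 'I_n}) (p : nat -> 'I_n) (t : nat).
Hypothesis run : greedy_run A B S p t.

Lemma run_indep k : (1 <= k <= t)%N -> indep A (S k).
Proof.
case: run => S1 Sk; elim: k => // k IHk /andP[_ kt].
case: k => [|k] in IHk kt *; first by rewrite S1; exact: indep0.
have [gp _ ->] := Sk k.+1 kt.
by apply: indepU1 => //; apply: IHk; exact: ltnW.
Qed.

(** The first projection is zero, so [H] starts at [B^T A]; each iteration then subtracts one
    rank-one term. *)
Lemma run_gramH k : (1 <= k <= t)%N ->
  gramH A B (S k) = B^T *m A -
    \sum_(1 <= s < k) upsilon A B (S s) (p s) *m (omega A (S s) (p s))^T.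
Proof.
case: run => S1 Sk; elim: k => // k IHk /andP[_ kt].
case: k => [|k] in IHk kt *.
  by rewrite S1 big_nil subr0 /gramH /resF /resE proj_set0 !mul0mx !subr0.
have [gp _ ->] := Sk k.+1 kt.
have kt' : (1 <= k.+1 <= t)%N by exact: ltnW.
have iS := run_indep kt'.
by rewrite gramH_update // IHk // [in RHS]big_nat_recr //= opprD addrA.
Qed.

End Run.

Theorem theorem3 (R : realType) (m n r : nat)
    (A : 'M[R]_(m, n)) (B : 'M[R]_(m, r))
    (S : nat -> {set 'I_n}) (p : nat -> 'I_n) (t : nat)
    (t_ge2 : (2 <= t)%N) (run : greedy_run A B S p t) :
  let f k := fvec A B (S k) in
  let g k := gvec A (S k) in
  let w k := omega A (S k) (p k) in
  let v k := upsilon A B (S k) (p k) in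
  f t = f (t - 1)%N
        - 2 *: hadamard (w (t - 1)%N)
                 (A^T *m B *m v (t - 1)%N
                  - \sum_(1 <= s < t - 1) ((v s)^T *m v (t - 1)%N) 0 0 *: w s)
        + enorm (v (t - 1)%N) ^+ 2 *: hadamard (w (t - 1)%N) (w (t - 1)%N)
  /\ g t = g (t - 1)%N - hadamard (w (t - 1)%N) (w (t - 1)%N).
Proof.
move=> f g w v; case: t t_ge2 run => [|[|k]] // _ run.
rewrite /f /g subn1 /=.
have [gp _ ->] := proj2 run k.+1 (ltnSn _).
have kt : (1 <= k.+1 <= k.+2)%N by exact: leqnSn.
have iS := run_indep run kt.
split; last exact: gvec_update.
(* Only [H^T v] remains to be unrolled: each term [w_s v_s^T v] is the scalar [v_s^T v] times
   [w_s]. *)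
suff Hv : (gramH A B (S k.+1))^T *m v k.+1 =
    A^T *m B *m v k.+1 - \sum_(1 <= s < k.+1) ((v s)^T *m v k.+1) 0 0 *: w s.
  by rewrite fvec_update // Hv.
rewrite (run_gramH run) // [(_ - _)^T]linearB /= trmx_mul trmxK mulmxBl.
congr (_ - _); rewrite [(\sum_(_ <= _ < _) _)^T]linear_sum /= mulmx_suml.
apply: eq_bigr => s _; rewrite trmx_mul trmxK -mulmxA.
by rewrite [X in _ *m X]mx11_scalar mul_mx_scalar.
Qed.
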